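(* Let $r,s\ge1$ be integers. For all integers $n\ge 1$, \[ \bar{a}_{r,s}(n)\equiv \begin{cases} 2s\pmod 4, & \text{if } n=k^2 \text{ for some integer } k,\\ 2(r+s)\pmod 4, & \text{if } n=2k^2 \text{ for some integer } k,\\ 0 \pmod 4, & \text{otherwise}. \end{cases} \]
   Context: For $m\ge1$ let $f_m:=\prod_{k=1}^{\infty}(1-q^{mk})$. For integers $r,s\ge1$, $\bar{a}_{r,s}(n)$ denotes the number of overpartitions of $n$ (partitions in which the first occurrence of each part size may be overlined) wherein each even part may appear in one of $r$ colors and each odd part in one of $s$ colors; its generating function is \[ \sum_{n=0}^{\infty}\bar{a}_{r,s}(n)q^n=\frac{f_2^{3s-2r}}{f_1^{2s}f_4^{s-r}}. \] *)

(* Defs.v *)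
From mathcomp Require Import all_boot.

Set Implicit Arguments.
Unset Strict Implicit.
Unset Printing Implicit Defensive.

Definition ncolors (r s k : nat) : nat := if odd k then s else r.

(* Parts of a partition of n: a pair (i, c) stands for the part of size i.+1, *)
(* 1 <= i.+1 <= n, in color c.                                                *)
Definition cpart (r s n : nat) : finType :=
  {i : 'I_n & 'I_(ncolors r s i.+1)} : finType.

Definition psize (r s n : nat) (c : cpart r s n) : nat := (tag c).+1.

(* A colored overpartition of n is a pair (m, o): m c is the multiplicity of  *)
(* the colored part c (at most n, since sizes are positive), and o is the set *)
(* of those colored parts whose first occurrence is overlined. Copies of one  *)
(* size in different colors are different parts, and may be overlined         *)
(* independently; this is what the product                                    *)
(*   \prod_(k even) ((1 + q^k) / (1 - q^k))^r                                 *)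
(*     * \prod_(k odd) ((1 + q^k) / (1 - q^k))^s                              *)
(*   = f_2^(3s-2r) / (f_1^(2s) f_4^(s-r))                                     *)
(* enumerates.                                                                *)
Definition overpartitions (r s n : nat) :
    {set {ffun cpart r s n -> 'I_n.+1} * {set cpart r s n}} :=
  [set p : {ffun cpart r s n -> 'I_n.+1} * {set cpart r s n}
     | (\sum_(c : cpart r s n) p.1 c * psize c == n)
       && (p.2 \subset [set c : cpart r s n | 0 < p.1 c])].

Definition abar (r s n : nat) : nat := #|overpartitions r s n|.

(* Main.v *)
(* A multiplicity function with support of size j carries 2^j overlinings, so  *)
(* modulo 4 only j = 1 survives when n >= 1, and abar(n) is twice the sum over *)
(* the divisors d of n of the number of colors of d. Even divisors of n are    *)
(* the doubles of divisors of n/2, so, writing tau for the number of divisors, *)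
(* modulo 2 this sum is s tau(n) + (r + s) tau(n/2), with the last term absent *)
(* for n odd. Finally tau(n) is odd exactly when n is a square.                *)
Require Import Defs.
From mathcomp Require Import all_boot.

(** The overlinings are counted first ([abar_sum_pow2], [pow2_card_supp_mod4]). What survives modulo
    4 is twice the number of colored parts whose size divides [n], each repeated to fill [n]
    ([card_singleton_supp], [abar_mod4]). Only the parity of that number matters: [odd_sum_ncolors]
    splits it into two terms, governed by whether [n] and its half are squares. The two conditions
    exclude each other, so at most one term contributes. *)

(** The involution sending [d] to [n %/ d] swaps the divisors below and above the square root of
    [n]; only a divisor equal to the root is unpaired. *)
Lemma odd_size_divisors n : 0 < n ->
  odd (size (divisors n)) = has (fun d => d ^ 2 == n) (divisors n).
Proof.
move=> n_gt0; set D := divisors n.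
have mapD : perm_eq D (map (fun d => n %/ d) D).
  have divK d : d \in D -> n %/ (n %/ d) = d.
    rewrite -dvdn_divisors // => /dvdnP[e nE]; move: n_gt0.
    by rewrite nE muln_gt0 => /andP[e_gt0 d_gt0]; rewrite mulnK // mulKn.
  have divD d : d \in D -> n %/ d \in D.
    by rewrite -!dvdn_divisors // => /dvdn_div.
  apply: uniq_perm; first exact: divisors_uniq.
    rewrite map_inj_in_uniq ?divisors_uniq // => d e dD eD /(congr1 (divn n)).
    by rewrite !divK.
  move=> d; apply/idP/mapP => [dD | [e eD ->]]; last exact: divD.
  by exists (n %/ d); [apply: divD | rewrite divK].
have gtE : count (fun d => n < d ^ 2) D = count (fun d => d ^ 2 < n) D.
  rewrite (permP mapD) count_map; apply: eq_in_count => d.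
  rewrite -dvdn_divisors //= => /dvdnP[e nE].
  move: n_gt0; rewrite nE muln_gt0 => /andP[e_gt0 d_gt0].
  by rewrite mulnK // expnS expn1 ltn_pmul2l // expnS expn1 ltn_pmul2r.
have eqE : count (fun d => d ^ 2 == n) D = has (fun d => d ^ 2 == n) D.
  case: hasP => [[d dD /eqP dn] | noD].
    rewrite (@eq_count _ _ (pred1 d)); last first.
      by move=> e /=; rewrite -dn eqn_exp2r.
    by rewrite count_uniq_mem ?divisors_uniq // dD.
  by apply/eqP; rewrite eqn0Ngt -has_count; apply/hasP.
have ltgtE : count (predC (fun d => d ^ 2 == n)) D =
    (count (fun d => d ^ 2 < n) D).*2.
  (* By trichotomy, the unequal case is the disjoint union of the two strict ones. *)
  rewrite -addnn -{1}gtE -count_predUI.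
  rewrite [X in _ + X](@eq_count _ _ pred0) ?count_pred0 ?addn0; last first.
    by move=> d /=; case: ltngtP.
  by apply: eq_count => d /=; case: ltngtP.
rewrite -(count_predC (fun d => d ^ 2 == n)) eqE oddD.
by rewrite ltgtE odd_double addbF oddb.
Qed.

Lemma odd_size_divisorsP n : 0 < n ->
  reflect (exists k, n = k ^ 2) (odd (size (divisors n))).
Proof.
move=> n_gt0; rewrite odd_size_divisors //.
apply: (iffP hasP) => [[k _ /eqP <-] | [k nE]]; first by exists k.
by exists k; rewrite -?dvdn_divisors // nE ?dvdn_exp.
Qed.

(** The 2-adic valuation is odd on the left and even on the right. *)
Lemma double_sqr_neq_sqr j k : 0 < j -> 2 * j ^ 2 <> k ^ 2.
Proof.
move=> j_gt0 /(congr1 (fun m => odd (logn 2 m))).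
by rewrite lognM ?expn_gt0 ?j_gt0 // !lognX oddD !oddM.
Qed.

Lemma count_even_divisors n : 0 < n ->
  count (predC odd) (divisors n) = if odd n then 0 else size (divisors n./2).
Proof.
move=> n_gt0; case: ifPn => [n_odd | n_even].
  apply/eqP; rewrite eqn0Ngt -has_count; apply/hasPn => d.
  by rewrite -dvdn_divisors //= negbK => /dvdn_odd; apply.
have nE : n = (n./2).*2 by rewrite even_halfK.
have m_gt0 : 0 < n./2 by rewrite -double_gt0 -nE.
rewrite -size_filter -(size_map double (divisors _)); apply: perm_size; apply: uniq_perm.
- by rewrite filter_uniq ?divisors_uniq.
- by rewrite (map_inj_uniq double_inj) divisors_uniq.
move=> d; rewrite mem_filter -dvdn_divisors //=.
apply/andP/mapP => [[/even_halfK <-] | [e]].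
  by rewrite {1}nE -!mul2n dvdn_pmul2l // => dn; exists d./2;
    rewrite -?dvdn_divisors ?mul2n.
by rewrite -dvdn_divisors // => en ->; rewrite odd_double nE -!mul2n dvdn_pmul2l.
Qed.

(** With O odd and E even divisors the sum is sO + rE, congruent to s(O + E) + (r + s)E modulo 2. *)
Lemma odd_sum_ncolors r s n : 0 < n ->
  odd (\sum_(d <- divisors n) ncolors r s d) =
  (odd s && odd (size (divisors n)))
    (+) (odd (r + s) && (~~ odd n && odd (size (divisors n./2)))).
Proof.
move=> n_gt0.
have -> : \sum_(d <- divisors n) ncolors r s d =
    s * count odd (divisors n) + r * count (predC odd) (divisors n).
  rewrite (bigID odd) /= -!sum1_count !big_distrr /=; congr (_ + _).
    by apply: eq_bigr => d d_odd; rewrite /ncolors d_odd muln1.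
  by apply: eq_bigr => d /negPf d_even; rewrite /ncolors d_even muln1.
rewrite -[size (divisors n)](count_predC odd) !oddD !oddM.
rewrite count_even_divisors //.
by case: (odd n); case: (odd (size _)); case: (odd s); case: (odd r);
  case: (odd (count _ _)).
Qed.

Section CountMod4.

Variables r s n : nat.
Hypothesis n_gt0 : 0 < n.

Notation part := (cpart r s n).
Notation mult := {ffun part -> 'I_n.+1}.

Let weight (m : mult) := \sum_(c : part) m c * psize c.
Let supp (m : mult) := [set c | 0 < m c].

Lemma abar_sum_pow2 : abar r s n = \sum_(m | weight m == n) 2 ^ #|supp m|.
Proof.
rewrite /abar /overpartitions -sum1_card.
under eq_bigl do rewrite inE.
rewrite -(pair_big_dep (fun m : mult => weight m == n)
  (fun m (o : {set part}) => o \subset supp m) (fun _ _ => 1)) /=.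
apply: eq_bigr => m _; rewrite -card_powerset -sum1_card.
by apply: eq_bigl => o; rewrite powersetE.
Qed.

Lemma pow2_card_supp_mod4 m : weight m == n ->
  2 ^ #|supp m| = 2 * (#|supp m| == 1) %[mod 4].
Proof.
move=> /eqP wE; case E: #|supp m| => [|[|j]] //=; last first.
  by rewrite !expnS mulnA (modnMr _ 4).
(* An empty support would force weight 0. *)
suff : n = 0 by move=> n0; move: n_gt0; rewrite [X in _ < X]n0.
rewrite -wE /weight big1 // => c _.
by have := in_set0 c; rewrite -(cards0_eq E) inE lt0n => /negbFE/eqP->.
Qed.

(** The only candidate of weight [n] supported on [c] alone; it has that weight when [psize c]
    divides [n]. The quotient is at most [n], so [inord] does not truncate it. *)
Let single (c : part) : mult :=
  [ffun c' => if c' == c then inord (n %/ psize c) else ord0].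

Lemma singleE c : single c c = n %/ psize c :> nat.
Proof. by rewrite ffunE eqxx inordK // ltnS leq_div. Qed.

Lemma single_neq c c' : c' != c -> single c c' = 0 :> nat.
Proof. by rewrite ffunE => /negPf->. Qed.

Lemma supp_single c : psize c %| n -> supp (single c) = [set c].
Proof.
move=> cn; apply/setP => c'; rewrite !inE.
have [-> | /single_neq-> //] := eqVneq c' c.
by rewrite singleE divn_gt0 // dvdn_leq.
Qed.

Lemma card_singleton_supp :
  #|[set m | (weight m == n) && (#|supp m| == 1)]| =
  #|[set c : part | psize c %| n]|.
Proof.
rewrite -(@card_in_imset _ _ single [set c : part | psize c %| n]); last first.
  move=> c c'; rewrite !inE => cn cn' /(congr1 supp).
  by rewrite !supp_single // => /set1_inj.
apply: eq_card => m; rewrite inE; apply/andP/imsetP.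
  move=> [/eqP wE /cards1P[c suppE]].
  have m0 c' : c' != c -> m c' = 0 :> nat.
    move=> c'c; apply/eqP; rewrite eqn0Ngt.
    by have /setP/(_ c') := suppE; rewrite !inE (negPf c'c) => ->.
  have nE : n = m c * psize c.
    rewrite -{1}wE /weight (bigD1 c) //= big1 ?addn0 // => c' /m0 ->.
    by rewrite mul0n.
  exists c; first by rewrite inE {2}nE dvdn_mull.
  apply/ffunP => c'; apply: val_inj => /=.
  have [-> | c'c] := eqVneq c' c; last by rewrite m0 // single_neq.
  by rewrite singleE [X in X %/ _]nE mulnK.
move=> [c]; rewrite inE => cn ->; rewrite supp_single // cards1; split=> //.
rewrite /weight (bigD1 c) //= singleE divnK // big1 ?addn0 // => c' c'c.
by rewrite single_neq.
Qed.

Lemma card_dvd_part :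
  #|[set c : part | psize c %| n]| = \sum_(d <- divisors n) ncolors r s d.
Proof.
transitivity (\sum_(i < n | i.+1 %| n) ncolors r s i.+1).
  rewrite -sum1_card; under eq_bigl do rewrite inE.
  (* Writing each number of colors as a sum of ones turns the right side into a sum over pairs of a
     size and a color, that is, over colored parts. *)
  under [RHS]eq_bigr do rewrite -[ncolors _ _ _]card_ord -sum1_card.
  by rewrite sig_big_dep /=; apply: eq_bigl => c; rewrite andbT.
rewrite -(big_mkord (fun i => i.+1 %| n) (fun i => ncolors r s i.+1)).
rewrite -(big_add1 _ _ 0 n.+1 (fun d => d %| n) (fun d => ncolors r s d)).
rewrite -big_filter; apply: perm_big; apply: uniq_perm.
- by rewrite filter_uniq ?iota_uniq.
- exact: divisors_uniq.
move=> d; rewrite mem_filter mem_index_iota -dvdn_divisors //.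
case dn: (d %| n) => //=.
by rewrite (dvdn_gt0 n_gt0 dn) ltnS dvdn_leq.
Qed.

Lemma abar_mod4 :
  abar r s n = 2 * \sum_(d <- divisors n) ncolors r s d %[mod 4].
Proof.
rewrite abar_sum_pow2 -card_dvd_part -card_singleton_supp -sum1_card.
(* Each summand is replaced modulo 4 by twice an indicator, so the sum becomes twice a count. *)
rewrite -modn_summ (eq_bigr _ pow2_card_supp_mod4) modn_summ -big_distrr /=.
congr ((2 * _) %% 4); under [RHS]eq_bigl do rewrite inE.
by rewrite big_mkcondr; apply: eq_bigr => m _; case: eqP.
Qed.

End CountMod4.

Lemma modn4_double_odd a b : odd a = odd b -> 2 * a = 2 * b %[mod 4].
Proof.
by move=> ab; rewrite -(@muln_modr 2 a 2) -(@muln_modr 2 b 2) !modn2 ab.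
Qed.

Theorem theorem1p3 (r s : nat) (hr : 1 <= r) (hs : 1 <= s)
    (n : nat) (hn : 1 <= n) :
  [/\ (exists k : nat, n = k ^ 2) -> abar r s n = 2 * s %[mod 4],
      (exists k : nat, n = 2 * k ^ 2) -> abar r s n = 2 * (r + s) %[mod 4]
    & ~ (exists k : nat, n = k ^ 2) -> ~ (exists k : nat, n = 2 * k ^ 2) ->
      abar r s n = 0 %[mod 4] ].
Proof.
have sqP := odd_size_divisorsP n hn.
have dblP : reflect (exists k, n = 2 * k ^ 2)
    (~~ odd n && odd (size (divisors n./2))).
  have half_gt0 : ~~ odd n -> 0 < n./2.
    by move=> n_even; rewrite -double_gt0 even_halfK.
  apply: (iffP andP) => [[n_even] | [k nE]].
    move=> /(odd_size_divisorsP _ (half_gt0 n_even))[k halfE].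
    by exists k; rewrite -halfE mul2n even_halfK.
  have n_even : ~~ odd n by rewrite nE oddM.
  split=> //; apply/(odd_size_divisorsP _ (half_gt0 n_even)).
  by exists k; rewrite nE mul2n doubleK.
have exclusive : (exists k, n = k ^ 2) -> ~ (exists k, n = 2 * k ^ 2).
  move=> [k nk] [j nj]; apply: (double_sqr_neq_sqr j k); last by rewrite -nj.
  (* Here [j] is positive because [j = 0] would give [n = 0]. *)
  by move: hn; rewrite nj; case: (j).
rewrite abar_mod4 //; split=> [sq | dbl | nsq ndbl].
- apply: modn4_double_odd; rewrite odd_sum_ncolors //.
  by rewrite (introT sqP sq) (introF dblP (exclusive sq)) andbT andbF addbF.
- apply: modn4_double_odd; rewrite odd_sum_ncolors //.
  rewrite (introT dblP dbl) (introF sqP) ?andbT ?andbF //.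
  by move=> /exclusive; apply.
- rewrite -[0](muln0 2); apply: modn4_double_odd; rewrite odd_sum_ncolors //.
  by rewrite (introF sqP nsq) (introF dblP ndbl) !andbF.
Qed.
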